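(* Let $k\ge 2$ and suppose that $n+1\ge 8k$. If $\mathcal A\subseteq\mathcal F_k(M_n)$ is intersecting, then $$|\mathcal A|\le \genfrac{[}{]}{0pt}{}{n-1}{k-1}.$$ Equality holds if and only if $\mathcal A$ is a full edge-star, i.e. $\mathcal A=\{F\in\mathcal F_k(M_n): a\le F\}$ for some atom $a$ of the lattice of flats of $M_n$.
   Context: Let $\Omega_n=\{0,1,\dots,n\}$ and let $M_n=M(K_{n+1})$ be the graphic matroid of the complete graph on vertex set $\Omega_n$. Its lattice of flats, ordered by inclusion, is identified with the lattice of set partitions of $\Omega_n$ ordered by refinement (finer $\le$ coarser): the partition $\pi$ corresponds to the flat that is the union of the edge sets of the complete graphs on the blocks of $\pi$, and this flat has rank $\operatorname{rk}=n+1-|\pi|$, where $|\pi|$ is the number of blocks. Meet $\wedge$ is set intersection of flats (common refinement of partitions). Atoms are the rank-one flats (single edges $xy$). $\mathcal F_k(M_n)$ is the set of rank-$k$ flats, i.e. partitions of $\Omega_n$ into $n+1-k$ nonempty blocks. A nonempty family $\mathcal A\subseteq \mathcal F_k(M_n)$ is intersecting if $\operatorname{rk}(A\wedge B)\ge 1$ for all $A,B\in\mathcal A$ (equivalently, some two distinct elements of $\Omega_n$ lie in a common block of $A$ and in a common block of $B$). Families called intersecting are always assumed nonempty. For $0\le y\le x$, $\genfrac{[}{]}{0pt}{}{x}{y}:=S(x+1,x+1-y)$, where $S(N,b)$ is the Stirling number of the second kind (number of partitions of an $N$-set into $b$ nonempty blocks). *)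

(* Defs.v *)
From mathcomp Require Import all_boot.

Set Implicit Arguments.
Unset Strict Implicit.
Unset Printing Implicit Defensive.

(* A flat of the graphic matroid M(K_{n+1}) is identified with a set partition
   of the vertex set {0, ..., n} = 'I_n.+1, represented as its set of blocks;
   [flat_edges] below is the edge set it stands for. *)
Definition flats (n : nat) : {set {set {set 'I_n.+1}}} :=
  [set P | partition P [set: 'I_n.+1]].

(* The subtraction does not truncate on flats: a flat has at most n+1 blocks. *)
Definition rk (n : nat) (P : {set {set 'I_n.+1}}) : nat := n.+1 - #|P|.

Definition flat_le (n : nat) (P Q : {set {set 'I_n.+1}}) : bool :=
  [forall B in P, exists C in Q, B \subset C].

Definition flat_meet (n : nat) (P Q : {set {set 'I_n.+1}}) :
    {set {set 'I_n.+1}} :=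
  [set B :&: C | B in P, C in Q] :\ set0.

Definition flats_of_rank (n k : nat) : {set {set {set 'I_n.+1}}} :=
  [set P in flats n | rk P == k].

Definition atoms (n : nat) : {set {set {set 'I_n.+1}}} := flats_of_rank n 1.

Definition intersecting (n : nat) (A : {set {set {set 'I_n.+1}}}) : Prop :=
  A != set0 /\ forall P Q, P \in A -> Q \in A -> 1 <= rk (flat_meet P Q).

Definition full_edge_star (n k : nat) (A : {set {set {set 'I_n.+1}}}) : Prop :=
  exists2 a, a \in atoms n & A = [set F in flats_of_rank n k | flat_le a F].

Definition stirling2 (N b : nat) : nat :=
  #|[set P : {set {set 'I_N}} | partition P [set: 'I_N] & #|P| == b]|.

(* Only meaningful for y <= x. *)
Definition bracket (x y : nat) : nat := stirling2 x.+1 (x.+1 - y).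

Definition flat_edges (n : nat) (P : {set {set 'I_n.+1}}) :
    {set {set 'I_n.+1}} :=
  [set e : {set 'I_n.+1} | (#|e| == 2) && [exists B in P, e \subset B]].

(* The identification of partitions with edge sets turns refinement into
   inclusion and common refinement into intersection. *)
Lemma flat_edges_le (n : nat) (P Q : {set {set 'I_n.+1}}) :
  P \in flats n -> Q \in flats n ->
  flat_le P Q = (flat_edges P \subset flat_edges Q).
Proof.
rewrite !inE => PP /and3P[/eqP cQ tQ _].
apply/idP/subsetP => [/forall_inP PQ e | sPQ].
  rewrite !inE => /andP[-> /exists_inP[B BP eB]] /=.
  have /exists_inP[C CQ BC] := PQ _ BP.
  by apply/exists_inP; exists C => //; apply: subset_trans BC.
apply/forall_inP => B BP.
have [x xB]: exists x, x \in B.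
  by apply/set0Pn; apply: contraTneq BP => ->; case/and3P: PP.
have xQ : x \in cover Q by rewrite cQ inE.
apply/exists_inP; exists (pblock Q x); first by rewrite pblock_mem.
apply/subsetP => y yB; have [->|nxy] := eqVneq y x; first by rewrite mem_pblock.
have : [set x; y] \in flat_edges Q.
  apply: sPQ; rewrite inE cards2 (eq_sym x y) nxy /=; apply/exists_inP; exists B => //.
  by apply/subsetP => z /set2P[]->.
rewrite inE => /andP[_ /exists_inP[C CQ /subsetP eC]].
have xC : x \in C by apply: eC; rewrite !inE eqxx.
by rewrite (def_pblock tQ CQ xC) eC // !inE eqxx orbT.
Qed.

Lemma flat_edges_meet (n : nat) (P Q : {set {set 'I_n.+1}}) :
  flat_edges (flat_meet P Q) = flat_edges P :&: flat_edges Q.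
Proof.
apply/setP => e; rewrite !inE; have [e2|//] := eqVneq #|e| 2.
apply/exists_inP/andP => /= [[D] | [/exists_inP[B BP eB] /exists_inP[C CQ eC]]].
  rewrite !inE => /andP[_ /imset2P[B C BP CQ ->]]; rewrite subsetI => /andP[eB eC].
  by split; apply/exists_inP; [exists B | exists C].
have eBC : e \subset B :&: C by rewrite subsetI eB.
exists (B :&: C) => //; rewrite !inE; apply/andP; split.
  by apply: contraTneq eBC => ->; rewrite subset0 -cards_eq0 e2.
by apply/imset2P; exists B C.
Qed.

Lemma flat_meet_flat (n : nat) (P Q : {set {set 'I_n.+1}}) :
  P \in flats n -> Q \in flats n -> flat_meet P Q \in flats n.
Proof.
rewrite !inE => /and3P[/eqP cP tP _] /and3P[/eqP cQ tQ _].
apply/and3P; split; last by rewrite !inE eqxx.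
  rewrite eqEsubset subsetT; apply/subsetP => x _.
  have xP : x \in cover P by rewrite cP inE.
  have xQ : x \in cover Q by rewrite cQ inE.
  have xPQ : x \in pblock P x :&: pblock Q x by rewrite inE !mem_pblock xP.
  apply/bigcupP; exists (pblock P x :&: pblock Q x) => //.
  rewrite !inE; apply/andP; split; first by apply: contraTneq xPQ => ->; rewrite inE.
  by apply/imset2P; exists (pblock P x) (pblock Q x); rewrite ?pblock_mem.
apply/trivIsetP => D E.
rewrite !inE => /andP[_ /imset2P[B C BP CQ ->]] /andP[_ /imset2P[B' C' BP' CQ' ->]].
apply: contraNT => /pred0Pn[x /andP[]]; rewrite /= !inE => /andP[xB xC] /andP[xB' xC'].
rewrite -(def_pblock tP BP xB) -(def_pblock tP BP' xB').
by rewrite -(def_pblock tQ CQ xC) -(def_pblock tQ CQ' xC').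
Qed.

(* Main.v *)
Require Import Defs.
From mathcomp Require Import all_boot.
From mathcomp Require Import zify.

Set Implicit Arguments.
Unset Strict Implicit.
Unset Printing Implicit Defensive.

(* Call a flat light if it has at most 7k edges and heavy otherwise, and let
   "star" be the size of a full edge-star.  Contracting one more edge multiplies
   the number of rank-k flats above a given flat by at most 2/(49k), by the
   inequality j h_j >= p_1 h_(j-1) between symmetric functions of 1, .., m.
   Let A be intersecting without an edge common to all its members.
   - Light members without common edge: let s >= 2 be the least rank of a flat
     meeting all of them.  Starting from an edge of such a flat, branch s - 1
     times over the at most 7k edges of a light member missed so far: each step
     costs a factor 2/7, so they are at most 3 (2/7) star = 6/7 star in number.
   - Heavy members with at least E > 7k edges: a flat with that many edges has
     many sequences of j ~ sqrt E independent edges, which makes such flats rare: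
     at most (3/8)^j star of them contain a given edge.  As the members all meet
     a fixed one with E edges, there are fewer than (3/4)^(j+1) star of them.
   - If the light members share an edge e, some heavy H in A does not contain
     e; the flats above e disjoint from H are missing from A.  Building partitions
     by inserting vertices one at a time, they are at least (3/4)^(j+1) star, which
     outweighs the members of A that do not contain e. *)

(** The Stirling numbers of the second kind, by their recurrence; [stirling2E] proves the agreement
    with [stirling2]. *)
Fixpoint st (N m : nat) : nat :=
  match N, m with
  | 0, 0 => 1
  | 0, _.+1 => 0
  | _.+1, 0 => 0
  | N'.+1, m'.+1 => st N' m' + m * st N' m
  end.

Definition parts (T : finType) (D : {set T}) (m : nat) : {set {set {set T}}} :=
  [set P : {set {set T}} | partition P D & #|P| == m].

Definition tog (T : finType) (P : {set {set T}}) (x y : T) : bool :=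
  [exists B in P, (x \in B) && (y \in B)].

Definition ins (T : finType) (v : T) (P : {set {set T}}) (B : {set T}) :
    {set {set T}} := (v |: B) |: (P :\ B).

(** * Partitions and Stirling numbers *)

Section Insert.

Variables (T : finType) (D : {set T}) (v : T).
Hypothesis vD : v \notin D.

Lemma partition_nin (P : {set {set T}}) (B : {set T}) :
  partition P D -> v \in B -> B \notin P.
Proof.
move=> pP vB; apply: contra vD => BP.
by apply: (subsetP (partitionS pP BP)).
Qed.

Lemma partition_ins1 (P : {set {set T}}) :
  partition P D -> partition ([set v] |: P) (v |: D).
Proof.
move=> pP; apply: partitionU1 => //; last by rewrite disjoints1.
by apply/set0Pn; exists v; rewrite inE.
Qed.

Lemma partition_ins (P : {set {set T}}) (B : {set T}) :
  partition P D -> B \in P -> partition (ins v P B) (v |: D).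
Proof.
move=> pP BP; have BD := partitionS pP BP.
have -> : v |: D = (v |: B) :|: (D :\: B).
  apply/setP => z; rewrite !inE -orbA; congr (_ || _).
  by case zB: (z \in B); rewrite //= (subsetP BD).
apply: partitionU1; first exact: partitionD1.
  by apply/set0Pn; exists v; rewrite !inE eqxx.
rewrite -setI_eq0; apply/eqP/setP => z; rewrite !inE.
by have [->|_] := eqVneq z v; rewrite ?(negPf vD) ?andbF //=; case: (z \in B).
Qed.

Lemma card_ins (P : {set {set T}}) (B : {set T}) :
  partition P D -> B \in P -> #|ins v P B| = #|P|.
Proof.
move=> pP BP; rewrite cardsU1 (cardsD1 B P) BP; congr (_ + _).
by rewrite inE negb_and (partition_nin pP) ?orbT // !inE eqxx.
Qed.

Lemma pblock_ins (P : {set {set T}}) (B : {set T}) :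
  partition P D -> B \in P -> pblock (ins v P B) v = v |: B.
Proof.
move=> pP BP; apply: def_pblock; rewrite ?inE ?eqxx //.
exact: partition_trivIset (partition_ins pP BP).
Qed.

Lemma ins_inj (z1 z2 : {set {set T}} * {set T}) :
  partition z1.1 D -> z1.2 \in z1.1 -> partition z2.1 D -> z2.2 \in z2.1 ->
  ins v z1.1 z1.2 = ins v z2.1 z2.2 -> z1 = z2.
Proof.
case: z1 z2 => [P B] [P' B'] /= pP BP pP' BP' e.
have vB : v \notin B by apply: contra vD; apply/subsetP/(partitionS pP).
have vB' : v \notin B' by apply: contra vD; apply/subsetP/(partitionS pP').
have eB : v |: B = v |: B' by rewrite -(pblock_ins pP BP) e pblock_ins.
have eB2 : B = B' by rewrite -(setU1K vB) eB setU1K.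
subst B'; congr (_, _).
have nB R : partition R D -> (v |: B) \notin R :\ B.
  by move=> pR; rewrite inE negb_and (partition_nin pR) ?orbT // !inE eqxx.
have eP : P :\ B = P' :\ B by rewrite -(setU1K (nB _ pP)) -/(ins v P B) e setU1K ?nB.
by rewrite -(setD1K BP) eP setD1K.
Qed.

Lemma ins_surj (P' : {set {set T}}) :
  partition P' (v |: D) -> [set v] \notin P' ->
  exists P B, [/\ partition P D, B \in P & P' = ins v P B].
Proof.
move=> pP' nv; pose C := pblock P' v.
have vc : v \in cover P' by rewrite (cover_partition pP') !inE eqxx.
have CP' : C \in P' by apply: pblock_mem.
have vC : v \in C by rewrite mem_pblock.
have CD := partitionS pP' CP'.
have eC : v |: (C :\ v) = C by rewrite setD1K.
have dj : C :\ v \notin P' :\ C.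
  apply/negP; rewrite inE => /andP[_ bP].
  have nz : C :\ v != set0 by apply: contraTneq bP => ->; rewrite (partition0 pP').
  have /set0Pn[z zC] := nz.
  have := def_pblock (partition_trivIset pP') bP zC.
  have zC2 : z \in C by move: zC; rewrite inE => /andP[].
  rewrite (def_pblock (partition_trivIset pP') CP' zC2) => eCC.
  by move: vC; rewrite eCC !inE eqxx.
exists ((C :\ v) |: (P' :\ C)), (C :\ v); split.
- have -> : D = (C :\ v) :|: ((v |: D) :\: C).
    apply/setP => z; rewrite !inE.
    have [->|zv] := eqVneq z v; first by rewrite vC /= (negPf vD).
    case zC : (z \in C) => //=.
    by move/subsetP: CD => /(_ z zC); rewrite !inE (negPf zv).
  apply: partitionU1; first exact: partitionD1.
    apply/negP => /eqP C0; move: nv; rewrite -(_ : C = [set v]) ?CP' //.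
    by rewrite -eC C0 setU0.
  rewrite -setI_eq0; apply/eqP/setP => z; rewrite !inE.
  by case: (z \in C); rewrite ?andbF.
- by rewrite !inE eqxx.
- by rewrite /ins setU1K // eC setD1K.
Qed.

(** Deleting [v] either removes a singleton block or undoes a unique [ins]. The predicate [Q] lets
    the Stirling recurrence count restricted partitions: those coarser than a kernel in
    [card_coarser], those avoiding a flat in [insert_count]. *)
Lemma card_parts_insert (m : nat) (Q : pred {set {set T}}) :
  #|[set P in parts (v |: D) m.+1 | Q P]| =
  #|[set P in parts D m | Q ([set v] |: P)]| +
  \sum_(P in parts D m.+1) #|[set B in P | Q (ins v P B)]|.
Proof.
rewrite -(cardsID [set P : {set {set T}} | [set v] \in P]); congr (_ + _).
  rewrite -(card_in_imset (f := fun P => [set v] |: P)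
    (D := mem [set P in parts D m | Q ([set v] |: P)])); last first.
    move=> P1 P2; rewrite !inE => /andP[/andP[p1 _] _] /andP[/andP[p2 _] _] /= e.
    by rewrite -(setU1K (partition_nin p1 (set11 v))) e setU1K // (partition_nin p2) ?set11.
  apply: eq_card => P; apply/idP/imsetP => /=.
    rewrite !inE => /andP[/andP[/andP[pP cP] qP] vP].
    have eP : [set v] |: (P :\ [set v]) = P by rewrite setD1K.
    exists (P :\ [set v]); rewrite ?eP // !inE eP qP andbT.
    rewrite (cardsD1 [set v]) vP add1n eqSS in cP.
    rewrite cP andbT.
    suff -> : D = (v |: D) :\: [set v] by apply: partitionD1.
    by rewrite setU1K.
  case=> P1; rewrite !inE => /andP[/andP[p1 /eqP c1] q1] ->.
  rewrite !inE eqxx q1 partition_ins1 //= andbT.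
  by rewrite cardsU1 (partition_nin p1 (set11 v)) add1n c1 eqxx.
pose X := [set z : {set {set T}} * {set T} |
  [&& z.1 \in parts D m.+1, z.2 \in z.1 & Q (ins v z.1 z.2)]].
have -> : \sum_(P in parts D m.+1) #|[set B in P | Q (ins v P B)]| = #|X|.
  under eq_bigr do rewrite -sum1_card.
  rewrite pair_big_dep -sum1_card; apply: eq_bigl => z /=.
  by rewrite !inE.
rewrite -(card_in_imset (f := fun z => ins v z.1 z.2) (D := mem X)); last first.
  move=> z1 z2; rewrite !inE => /and3P[/andP[p1 _] b1 _] /and3P[/andP[p2 _] b2 _].
  exact: ins_inj.
apply: eq_card => P; apply/idP/imsetP => /=.
  rewrite !inE => /andP[vP /andP[/andP[pP cP] qP]].
  have [P1 [B [p1 B1 eP]]] := ins_surj pP vP.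
  exists (P1, B) => //; rewrite !inE /= p1 B1 -eP qP.
  by rewrite eP card_ins in cP => //; rewrite cP.
case=> [[P1 B]]; rewrite !inE /= => /and3P[/andP[p1 c1] b1 q1] ->.
rewrite q1 partition_ins // card_ins // c1 !andbT /= /ins !inE.
rewrite negb_or; apply/andP; split; last first.
  by rewrite negb_and (partition_nin p1) ?orbT // set11.
apply/negP => /eqP eB.
have /set0Pn[z zB] := partition_neq0 p1 b1.
have zD := subsetP (partitionS p1 b1) z zB.
have : z \in [set v] by rewrite eB !inE zB orbT.
by rewrite inE => /eqP zv; rewrite zv (negPf vD) in zD.
Qed.

End Insert.

(** * Vertices in a common block, and partitions coarser than a kernel *)

Section Together.

Variable T : finType.
Implicit Types (D : {set T}) (P : {set {set T}}).

Lemma togC P x y : tog P x y = tog P y x.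
Proof. by apply: eq_existsb => B; rewrite [(y \in B) && _]andbC. Qed.

Lemma tog_dom D P x y : partition P D -> tog P x y -> (x \in D) && (y \in D).
Proof.
move=> pP /exists_inP[B BP /andP[xB yB]].
by rewrite !(subsetP (partitionS pP BP)).
Qed.

Lemma tog_pblock D P x y : partition P D -> tog P x y = (y \in pblock P x).
Proof.
move=> pP; have tP := partition_trivIset pP.
apply/exists_inP/idP => [[B BP /andP[xB yB]]|]; first by rewrite (def_pblock tP BP xB).
have [xP yB|nx] := boolP (x \in cover P).
  by exists (pblock P x); rewrite ?pblock_mem // mem_pblock xP.
rewrite /pblock; case: pickP => [B /andP[BP xB]|_] /=; last by rewrite inE.
by case/negP: nx; apply/bigcupP; exists B.
Qed.

Lemma tog_block D P B x y :
  partition P D -> B \in P -> x \in B -> tog P x y = (y \in B).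
Proof.
by move=> pP BP xB; rewrite (tog_pblock _ _ pP) (def_pblock (partition_trivIset pP) BP xB).
Qed.

Lemma tog_refl D P x : partition P D -> x \in D -> tog P x x.
Proof.
by move=> pP xD; rewrite (tog_pblock _ _ pP) mem_pblock (cover_partition pP).
Qed.

Lemma tog_trans D P x y z : partition P D -> tog P x y -> tog P y z -> tog P x z.
Proof.
move=> pP /exists_inP[B BP /andP[xB yB]].
by rewrite (tog_block _ pP BP yB) (tog_block _ pP BP xB).
Qed.

Lemma tog_ins1 P v x y :
  tog ([set v] |: P) x y = ((x == v) && (y == v)) || tog P x y.
Proof.
apply/exists_inP/orP => [[B]|[/andP[/eqP-> /eqP->]|/exists_inP[B BP xyB]]].
- rewrite !inE => /orP[/eqP->|BP]; first by rewrite !inE => xy; left.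
  by move=> xy; right; apply/exists_inP; exists B.
- by exists [set v]; rewrite !inE eqxx.
- by exists B => //; rewrite !inE BP orbT.
Qed.

Lemma tog_ins_neq P B v x y :
  B \in P -> x != v -> y != v -> tog (ins v P B) x y = tog P x y.
Proof.
move=> BP xv yv; apply/exists_inP/exists_inP => [[C]|[C CP xyC]].
  rewrite !inE => /orP[/eqP->|/andP[_ CP]] xy; last by exists C.
  by exists B; rewrite // !inE (negPf xv) (negPf yv) in xy *.
have [eCB|nCB] := eqVneq C B.
  exists (v |: B); first by rewrite !inE eqxx.
  by rewrite -eCB !inE; case/andP: xyC => -> ->; rewrite !orbT.
by exists C => //; rewrite !inE nCB CP orbT.
Qed.

Lemma tog_ins_new D P B v y :
  v \notin D -> partition P D -> B \in P ->
  tog (ins v P B) v y = (y \in v |: B).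
Proof.
move=> vD pP BP; apply: (tog_block _ (partition_ins vD pP BP)); rewrite !inE eqxx //.
Qed.

Definition coarser (T' : finType) (f : T -> T') D P :=
  [forall x in D, forall y in D, (f x == f y) ==> tog P x y].

Lemma coarserP (T' : finType) (f : T -> T') D P :
  reflect {in D &, forall x y, f x = f y -> tog P x y} (coarser f D P).
Proof.
apply: (iffP forall_inP) => [h x y xD yD /eqP fxy|h x xD].
  by have /forall_inP/(_ y yD)/implyP/(_ fxy) := h x xD.
by apply/forall_inP => y yD; apply/implyP => /eqP; apply: h.
Qed.

Lemma parts0 D : D != set0 -> parts D 0 = set0.
Proof.
move=> D0; apply/setP => P; rewrite !inE; apply/negP => /andP[pP].
rewrite cards_eq0 => /eqP P0; move: D0.
by rewrite -(cover_partition pP) P0 /cover big_set0 eqxx.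
Qed.

Lemma partition_nonfull D P v : v \notin D -> partition P D -> forall y, ~~ tog P v y.
Proof.
by move=> vD pP y; apply: contra vD => t; have /andP[] := tog_dom pP t.
Qed.

(** These are in effect the partitions of the image of [f]. The induction inserts [v]: if [f v] is
    already a value, [v] must join the block of a [u] with that value; otherwise nothing restricts
    [v] and the Stirling recurrence results. *)
Lemma card_coarser (T' : finType) (f : T -> T') D m :
  #|[set P in parts D m | coarser f D P]| = st #|f @: D| m.
Proof.
move: {2}#|D| (erefl #|D|) => c; elim: c => [|c IHc] in D m *.
  move/eqP; rewrite cards_eq0 => /eqP->; rewrite imset0 cards0.
  have -> : [set P in parts set0 m | coarser f set0 P] =
            [set P : {set {set T}} | (P == set0) && (m == 0)].
    apply/setP => P; rewrite !inE partition_set0.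
    have [->|//] := eqVneq P set0; rewrite cards0 eq_sym andTb.
    by rewrite (_ : coarser _ _ _ = true) ?andbT //; apply/coarserP => x y; rewrite inE.
  case: m => [|m] /=.
    rewrite -(cards1 (set0 : {set {set T}})); apply: eq_card => P.
    by rewrite !inE andbT.
  by apply/eqP; rewrite cards_eq0; apply/eqP/setP => P; rewrite !inE andbF.
move=> cD; have /set0Pn[v vD0] : D != set0 by rewrite -card_gt0 cD.
have [D' eD vD] : exists2 D', D = v |: D' & v \notin D'.
  by exists (D :\ v); rewrite ?setD1K // !inE eqxx.
subst D; have cD' : #|D'| = c by move: cD; rewrite cardsU1 vD => -[].
case: m => [|m].
  rewrite parts0; last by rewrite -card_gt0 cD.
  rewrite imsetU1 cardsU1.
  rewrite (_ : [set P in set0 | _] = set0); last by apply/setP => P; rewrite !inE.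
  rewrite cards0; case fv : (f v \in f @: D') => //=.
  rewrite add0n; case e : #|f @: D'| => //; move/eqP: e.
  by rewrite cards_eq0 => /eqP e; rewrite e inE in fv.
have nv x : x \in D' -> x != v by apply: contraTneq => ->.
rewrite card_parts_insert // imsetU1 cardsU1.
have pD' P n : P \in parts D' n -> partition P D' by rewrite inE => /andP[].
case fv : (f v \in f @: D') => /=.
  have /imsetP[u uD fu] := fv.
  rewrite (_ : [set P in _ | _] = set0) ?cards0 ?add0n; last first.
    apply/setP => P; rewrite inE in_set0; apply/negP => /andP[/pD' pP].
    move=> /coarserP/(_ v u); rewrite !inE eqxx uD orbT => /(_ isT isT fu).
    by rewrite tog_ins1 (negPf (nv _ uD)) andbF (negPf (partition_nonfull vD pP u)).
  rewrite -IHc // -sum1_card (big_setID [set P | coarser f D' P]) /=.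
  rewrite [X in _ + X]big1 ?addn0; last first.
    move=> P; rewrite !inE => /andP[nP _]; apply/eqP; rewrite cards_eq0.
    apply/eqP/setP => B; rewrite !inE; apply/negP => /andP[BP /coarserP h].
    case/negP: nP; apply/coarserP => x y xD yD fxy.
    by rewrite -(tog_ins_neq BP (nv _ xD) (nv _ yD)) h // !inE ?xD ?yD orbT.
  rewrite [RHS](eq_bigl [in parts D' m.+1 :&: [set P | coarser f D' P]]); last first.
    by move=> P; rewrite !inE.
  apply: eq_bigr => P; rewrite 2!inE => /andP[/pD' pP /coarserP h].
  rewrite -(cards1 (pblock P u)); apply: eq_card => B; rewrite !inE.
  have ucov : u \in cover P by rewrite (cover_partition pP).
  apply/andP/eqP => [[BP /coarserP/(_ v u)]|->].
    rewrite !inE eqxx uD orbT => /(_ isT isT fu).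
    rewrite (tog_ins_new u vD pP BP) !inE (negPf (nv _ uD)) => uB.
    by rewrite (def_pblock (partition_trivIset pP) BP uB).
  have BP := pblock_mem ucov; split=> //; apply/coarserP.
  have new w : w \in D' -> f v = f w -> tog (ins v P (pblock P u)) v w.
    move=> wD fw; rewrite (tog_ins_new w vD pP BP) !inE.
    by rewrite -(tog_pblock _ _ pP) h ?orbT // -fu.
  move=> x y; rewrite !inE => /orP[/eqP->|xD] /orP[/eqP->|yD] fxy.
  - by rewrite (tog_ins_new v vD pP BP) !inE eqxx.
  - exact: new.
  - by rewrite togC; apply: new.
  - by rewrite (tog_ins_neq BP) ?nv // h.
rewrite /= -!IHc //; congr (_ + _).
  apply: eq_card => P; rewrite [in LHS]inE [in RHS]inE; apply: andb_id2l => /pD' pP.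
  apply/coarserP/coarserP => h x y.
    move=> xD yD fxy; have := h x y; rewrite !inE xD yD !orbT => /(_ isT isT fxy).
    by rewrite tog_ins1 (negPf (nv _ xD)).
  rewrite !inE tog_ins1 => /orP[/eqP->|xD] /orP[/eqP->|yD] fxy; rewrite ?eqxx //.
  - by move: fv; rewrite fxy imset_f.
  - by move: fv; rewrite -fxy imset_f.
  - by rewrite h ?orbT.
rewrite (big_setID [set P | coarser f D' P]) /=.
rewrite [X in _ + X]big1 ?addn0; last first.
  move=> P; rewrite !inE => /andP[nP _]; apply/eqP; rewrite cards_eq0.
  apply/eqP/setP => B; rewrite !inE; apply/negP => /andP[BP /coarserP h].
  case/negP: nP; apply/coarserP => x y xD yD fxy.
  by rewrite -(tog_ins_neq BP (nv _ xD) (nv _ yD)) h // !inE ?xD ?yD orbT.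
rewrite mulnC -sum_nat_const; apply: eq_big => [P|P]; first by rewrite !inE.
rewrite !inE => /andP[/andP[pP /eqP <-] /coarserP h].
apply: eq_card => B; rewrite !inE; apply: andb_idr => BP; apply/coarserP => x y.
rewrite !inE => /orP[/eqP->|xD] /orP[/eqP->|yD] fxy.
- by rewrite (tog_ins_new v vD pP BP) !inE eqxx.
- by move: fv; rewrite fxy imset_f.
- by move: fv; rewrite -fxy imset_f.
- by rewrite (tog_ins_neq BP) ?nv // h.
Qed.

Lemma card_parts D m : #|parts D m| = st #|D| m.
Proof.
rewrite -[in RHS](imset_id D) -card_coarser; apply: eq_card => P; rewrite [RHS]inE.
symmetry; apply: andb_idr; rewrite inE => /andP[pP _].
by apply/coarserP => x y xD _ <-; apply: tog_refl pP xD.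
Qed.

End Together.

Lemma stirling2E N b : stirling2 N b = st N b.
Proof. by rewrite /stirling2 -/(parts _ _) card_parts cardsT card_ord. Qed.

(** * Ratios of consecutive Stirling numbers *)

Lemma st_small N m : N < m -> st N m = 0.
Proof.
elim: N m => [|N IHN] [|m] //= lt; rewrite IHN; last by lia.
by rewrite IHN ?muln0 //; lia.
Qed.

Lemma stnn N : st N N = 1.
Proof. by elim: N => [|N /= ->] //; rewrite st_small ?muln0. Qed.

Lemma st_gt0 m j : 0 < m -> 0 < st (m + j) m.
Proof.
move=> m0; elim: j => [|j IHj]; first by rewrite addn0 stnn.
by case: m m0 IHj => // m _; rewrite addnS /=; lia.
Qed.

(* st (m + j) m is the complete homogeneous symmetric polynomial h_j(1, .., m),
   and this is j h_j >= p_1 h_(j-1), which is part of Newton's identity. *)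
Lemma st_newton m j : m * m.+1 * st (m + j) m <= 2 * j.+1 * st (m + j.+1) m.
Proof.
elim: m j => [|m IHm] // j.
have rec i : st (m.+1 + i.+1) m.+1 = st (m + i.+1) m + m.+1 * st (m.+1 + i) m.+1.
  by rewrite addSn /= addnS.
elim: j => [|j IHj].
  have := IHm 0; rewrite rec !addn0 !stnn; nia.
have := IHm j.+1; rewrite (rec j.+1); have := rec j.
move: (st _ _) (st _ _) (st (m + j.+2) m) (st (m.+1 + j) m.+1) IHj => a b c d; nia.
Qed.

(** Apply [st_newton] with [m = N - k >= 7 * k]: then [m * m.+1 >= 49 * k * k], while [j.+1 <= k];
    one [k] cancels. *)
Lemma st_pred_le N k q : 0 < k -> 8 * k <= N -> q < N ->
  49 * k * st q (N - k) <= 2 * st q.+1 (N - k).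
Proof.
move=> k0 kN qN; have [lt|le] := ltnP q (N - k); first by rewrite st_small ?muln0.
have := st_newton (N - k) (q - (N - k)).
have -> : N - k + (q - (N - k)) = q by lia.
have -> : N - k + (q - (N - k)).+1 = q.+1 by lia.
move: (st q _) (st q.+1 _) => a b h.
have h2 : (7 * k) * (7 * k) * a <= (N - k) * (N - k).+1 * a.
  by rewrite leq_mul2r leq_mul ?orbT //; lia.
have h3 : 2 * (q - (N - k)).+1 * b <= 2 * k * b by rewrite leq_mul2r; lia.
have : k * (49 * k * a) <= k * (2 * b) by lia.
by rewrite leq_pmul2l.
Qed.

(** The variant for gluing over all ordered pairs instead of those of one member; it rests on
    [7 * N <= 8 * (N - k)]. *)
Lemma st_pred_le_pairs N k q : 8 * k <= N -> q < N ->
  49 * (N * N.-1) * st q (N - k) <= 128 * k * st q.+1 (N - k).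
Proof.
move=> kN qN; have [lt|le] := ltnP q (N - k); first by rewrite st_small ?muln0.
have := st_newton (N - k) (q - (N - k)).
have -> : N - k + (q - (N - k)) = q by lia.
have -> : N - k + (q - (N - k)).+1 = q.+1 by lia.
move: (st q _) (st q.+1 _) => a b h.
have h2 : 49 * (N * N.-1) * a <= 64 * ((N - k) * (N - k).+1) * a.
  rewrite leq_mul2r; apply/orP; right.
  have : (7 * N) * (7 * N) <= (8 * (N - k)) * (8 * (N - k)) by rewrite leq_mul; lia.
  nia.
have h3 : 2 * (q - (N - k)).+1 * b <= 2 * k * b by rewrite leq_mul2r; lia.
lia.
Qed.

(** * Kernels of functions and their edges *)

(* A flat is often given as the kernel of a function [f] on the vertices; its rank
   is then [#|T| - #|f @: [set: T]|]. Edges are counted as ordered pairs, i.e. twice. *)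
Section Pairs.

Variables (T T' : finType).
Implicit Types (f : T -> T') (P F H : {set {set T}}) (A : {set {set {set T}}}).

Definition ker_pairs f : {set T * T} :=
  [set p | (p.1 != p.2) && (f p.1 == f p.2)].

Definition pairs_of P : {set T * T} :=
  [set p | (p.1 != p.2) && tog P p.1 p.2].

Definition above A f : {set {set {set T}}} :=
  [set F in A | coarser f [set: T] F].

(* The kernel of [glue f p] is the join of the kernel of [f] with the edge [p]. *)
Definition glue f (p : T * T) (x : T) : T' :=
  if f x == f p.2 then f p.1 else f x.

(** The image consists of [f x] and at most one value per point outside the fiber. *)
Lemma card_fiber f (x : T) :
  #|[set y | f y == f x]| <= (#|T| - #|f @: [set: T]|).+1.
Proof.
set B := [set y | _].
have sub : f @: [set: T] \subset f x |: f @: ~: B.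
  apply/subsetP => _ /imsetP[y _ ->]; rewrite !inE.
  have [//|n] := eqVneq (f y) (f x); apply: imset_f; by rewrite !inE.
have h1 := leq_trans (subset_leq_card sub) (leq_card_setU _ _).
have h2 : #|f @: ~: B| <= #|~: B| := leq_imset_card _ _.
by move: h1; rewrite cards1 -(cardsC B); lia.
Qed.

(** A class of size [b] has [b * b.-1 <= s.+1 * b.-1] ordered pairs by [card_fiber], and the numbers
    [b.-1] add up to the rank, at most [s]. *)
Lemma card_ker_pairs f s : #|T| <= #|f @: [set: T]| + s ->
  #|ker_pairs f| <= s * s.+1.
Proof.
move=> sN; pose b c := #|[set y | f y == c]|.
have bs c : c \in f @: [set: T] -> 0 < b c <= s.+1.
  case/imsetP => x _ ->; apply/andP; split; last by have := card_fiber f x; rewrite /b; lia.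
  by apply/card_gt0P; exists x; rewrite inE.
have eT : #|T| = \sum_(c in f @: [set: T]) b c.
  rewrite -cardsT -sum1_card (partition_big_imset f); apply: eq_bigr => c _.
  by rewrite /b -sum1_card; apply: eq_bigl => x; rewrite !inE.
have -> : #|ker_pairs f| = \sum_(c in f @: [set: T]) b c * (b c).-1.
  rewrite -sum1_card (partition_big (fun p => f p.1) (mem (f @: [set: T]))) /=; last first.
    by move=> p _; rewrite imset_f.
  apply: eq_bigr => c _.
  have -> : b c * (b c).-1 = \sum_(x | f x == c) (b c).-1.
    by rewrite sum_nat_const; congr (_ * _); apply: eq_card => x; rewrite !inE.
  transitivity (\sum_(x | f x == c) \sum_(y | (f y == c) && (y != x)) 1).
    rewrite pair_big_dep; apply: eq_bigl => -[x y]; rewrite !inE /=.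
    rewrite (eq_sym y x); case: (eqVneq (f x) c) => [->|_]; last by rewrite andbF.
    by rewrite andbT andbC eq_sym.
  apply: eq_bigr => x fx; rewrite sum1_card /b (cardsD1 x) inE fx add1n /=.
  by apply: eq_card => y; rewrite !inE unfold_in andbC.
apply: (@leq_trans (\sum_(c in f @: [set: T]) s.+1 * (b c).-1)).
  by apply: leq_sum => c /bs/andP[_ h]; rewrite leq_mul2r h orbT.
rewrite -big_distrr /= mulnC leq_mul2r; apply/orP; right.
have : \sum_(c in f @: [set: T]) b c = \sum_(c in f @: [set: T]) (b c).-1 + #|f @: [set: T]|.
  rewrite -sum1_card -big_split /=; apply: eq_bigr => c /bs/andP[h _].
  by rewrite addn1 prednK.
rewrite -eT; lia.
Qed.

Lemma card_glue f p : f p.1 != f p.2 ->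
  #|f @: [set: T]| = #|glue f p @: [set: T]|.+1.
Proof.
move=> np; rewrite (cardsD1 (f p.2)) imset_f //=; rewrite add1n; congr _.+1.
apply: eq_card => c; rewrite !inE; apply/andP/imsetP => [[nc /imsetP[x _ ex]]|[x _ ->]].
  by exists x; rewrite // /glue -ex (negPf nc).
by rewrite /glue; split; case: (eqVneq (f x) (f p.2)) => // _; rewrite imset_f.
Qed.

Lemma above_glue A f p :
  (forall F, F \in A -> partition F [set: T]) ->
  [set F in above A f | p \in pairs_of F] \subset above A (glue f p).
Proof.
move=> pA; apply/subsetP => F; rewrite !inE => /andP[/andP[FA /coarserP h] /andP[_ t]].
rewrite FA; apply/coarserP => x y _ _; rewrite /glue.
have pF := pA _ FA; have hh u w : f u = f w -> tog F u w by apply: h.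
case: eqVneq => [ex|_]; case: eqVneq => [ey|_] e.
- by apply: hh; rewrite ex ey.
- apply: (tog_trans pF (y := p.2)); first exact: hh.
  by rewrite togC; apply: (tog_trans pF (y := p.1)) t; apply: hh.
- by apply: (tog_trans pF (y := p.1)); [apply: hh|apply: (tog_trans pF t); apply: hh].
- exact: hh.
Qed.

Lemma card_above_parts f m :
  #|above (parts [set: T] m) f| = st #|f @: [set: T]| m.
Proof. exact: card_coarser. Qed.

Lemma double_count A (X : {set T * T}) c :
  (forall F, F \in A -> c <= #|X :&: pairs_of F|) ->
  c * #|A| <= \sum_(p in X) #|[set F in A | p \in pairs_of F]|.
Proof.
move=> h; under eq_bigr do rewrite -sum1_card.
rewrite (exchange_big_dep (mem A)) /=; last by move=> p F _; rewrite inE => /andP[].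
rewrite mulnC -sum_nat_const; apply: leq_sum => F FA.
rewrite (leq_trans (h _ FA)) // sum1_card subset_leq_card //.
by apply/subsetP => p; rewrite !inE => /andP[pX pF]; rewrite -topredE /= pX !inE FA.
Qed.

End Pairs.

Lemma card_neq_pairs (T : finType) :
  #|[set p : T * T | p.1 != p.2]| = #|T| * #|T|.-1.
Proof.
pose f (x : T) := tt.
have <- : #|ker_pairs f| = #|T| * #|T|.-1.
  rewrite -sum1_card; transitivity (\sum_(x : T) \sum_(y | y != x) 1).
    by rewrite pair_big_dep; apply: eq_bigl => -[x y]; rewrite !inE /= eqxx andbT eq_sym.
  rewrite (eq_bigr (fun=> #|T|.-1)) ?sum_nat_const // => x _.
  by rewrite sum1_card -(cardC1 x); apply: eq_card => y; rewrite !inE.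
by apply: eq_card => p; rewrite !inE eqxx andbT.
Qed.

Lemma card_symmetric_pairs (T : finType) (X : {set T * T}) p :
  (forall q, q \in X -> (q.2, q.1) \in X) ->
  (forall q, q \in X -> q.1 != q.2) -> p \in X -> 1 < #|X|.
Proof.
move=> sym irr pX; rewrite (cardD1 p) pX ltnS; apply/card_gt0P; exists (p.2, p.1).
rewrite !inE sym // andbT; apply: contraNneq (irr _ pX) => e.
by rewrite -[in X in X == _]e.
Qed.

(** A common edge appears in both orders; this 2 cancels the doubling in bounds on ordered pairs
    such as [14 * k]. *)
Lemma card_meet_pairs (T : finType) (P Q : {set {set T}}) p :
  p \in pairs_of P -> p \in pairs_of Q -> 1 < #|pairs_of P :&: pairs_of Q|.
Proof.
move=> pP pQ; apply: (@card_symmetric_pairs _ _ p); rewrite ?inE; last first.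
- by rewrite inE in pP; rewrite inE in pQ; rewrite pP.
- by move=> q; rewrite !inE => /andP[/andP[]].
move=> q; rewrite !inE /= (togC P) (togC Q) eq_sym.
by move=> /andP[-> ->].
Qed.

Lemma leq_imsetT (T T' : finType) (f : T -> T') : #|f @: [set: T]| <= #|T|.
Proof. by rewrite -[X in _ <= X]cardsT leq_imset_card. Qed.

(** * Counting light and heavy members *)

Section Families.

Variables (T : finType) (k : nat).
Hypotheses (k_gt0 : 0 < k) (leT : 8 * k <= #|T|).
Local Notation N := #|T|.
Local Notation flatk := (parts [set: T] (N - k)).
Implicit Types (A : {set {set {set T}}}).

Definition meeting A := forall P Q, P \in A -> Q \in A ->
  exists2 p, p \in pairs_of P & p \in pairs_of Q.

Lemma flatk_partition A F : A \subset flatk -> F \in A -> partition F [set: T].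
Proof. by move=> /subsetP h /h; rewrite inE => /andP[]. Qed.

Lemma card_above_le (T' : finType) A (f : T -> T') :
  A \subset flatk -> #|above A f| <= st #|f @: [set: T]| (N - k).
Proof.
move=> sA; rewrite -card_above_parts; apply: subset_leq_card; apply/subsetP => F.
by rewrite !inE => /andP[/(subsetP sA) + ->]; rewrite inE => ->.
Qed.

(* The hypothesis on [g] says that no flat of rank less than [s] meets all of [A]. *)
Lemma branching (T' : finType) A (f : T -> T') s d :
  A \subset flatk -> meeting A ->
  (forall F, F \in A -> #|pairs_of F| <= 14 * k) ->
  (forall g : T -> T', N < #|g @: [set: T]| + s ->
     exists2 H, H \in A & forall p, p \in pairs_of H -> g p.1 != g p.2) ->
  N + d = #|f @: [set: T]| + s ->
  7 ^ d * #|above A f| <= 2 ^ d * st #|f @: [set: T]| (N - k).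
Proof.
move=> sA mA light trans; elim: d f => [|d IHd] f eN.
  by rewrite !mul1n card_above_le.
(* The kernel of [f] has rank [s - d.+1 < s], so it misses some member [H]. *)
have [H HA sep] : exists2 H, H \in A & forall p, p \in pairs_of H -> f p.1 != f p.2.
  by apply: trans; rewrite -eN; lia.
have pA F : F \in A -> partition F [set: T] by apply: flatk_partition.
have [q eq] : exists q, #|f @: [set: T]| = q.+1.
  by have [p pHH _] := mA _ _ HA HA; exists #|glue f p @: [set: T]|; apply/card_glue/sep.
have IH p : p \in pairs_of H ->
    7 ^ d * #|[set F in above A f | p \in pairs_of F]| <= 2 ^ d * st q (N - k).
  move=> pH; have := card_glue (sep _ pH); rewrite eq => -[eg].
  rewrite eg; apply: leq_trans (IHd _ _); last by lia.
  by rewrite leq_mul2l (subset_leq_card (above_glue _ _ pA)) orbT.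
have main : 7 ^ d * (2 * #|above A f|) <= #|pairs_of H| * (2 ^ d * st q (N - k)).
  apply: (@leq_trans (\sum_(p in pairs_of H) 2 ^ d * st q (N - k))); last by rewrite sum_nat_const.
  apply: leq_trans (leq_sum _ IH); rewrite -big_distrr leq_mul2l; apply/orP; right.
  apply: double_count => F; rewrite inE => /andP[FA _].
  by have [p pH pF] := mA _ _ HA FA; apply: card_meet_pairs pH pF.
(* One step costs the factor [(14 * k / 2) * 2 / (49 * k) = 2 / 7]. *)
have hst : 49 * k * st q (N - k) <= 2 * st q.+1 (N - k).
  by apply: st_pred_le => //; rewrite -eq leq_imsetT.
rewrite eq; have := leq_trans main (leq_mul (light _ HA) (leqnn _)).
rewrite !expnS; move: (7 ^ d) (2 ^ d) (st q _) (st q.+1 _) hst => x y a b hst h.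
have : y * (49 * k * a) <= y * (2 * b) by rewrite leq_mul2l hst orbT.
lia.
Qed.

Lemma light_bound A :
  A \subset flatk -> meeting A -> A != set0 ->
  (forall F, F \in A -> #|pairs_of F| <= 14 * k) ->
  (forall x y, x != y -> exists2 F, F \in A & ~~ tog F x y) ->
  7 * #|A| <= 6 * st N.-1 (N - k).
Proof.
move=> sA mA A0 light nostar.
have pA F : F \in A -> partition F [set: T] by apply: flatk_partition.
(* A flat of rank at most [s], the kernel of [g], meets every member. Finite functions make this
   boolean, so that a least [s] exists; a constant map shows [cov N]. *)
pose cov s := [exists g : {ffun T -> {set T}}, (N <= #|g @: [set: T]| + s) &&
  [forall F in A, exists p in pairs_of F, g p.1 == g p.2]].
have [F0 F0A] := set0Pn _ A0.
have ex : exists s, cov s.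
  exists N; apply/existsP; exists [ffun => set0]; rewrite leq_addl /=.
  apply/forall_inP => F FA; have [p pF _] := mA _ _ FA FA.
  by apply/exists_inP; exists p; rewrite ?ffunE.
case: (ex_minnP ex) => s /existsP[g /andP[gN /forall_inP gA]] smin.
have trans (h : T -> {set T}) : N < #|h @: [set: T]| + s ->
    exists2 H, H \in A & forall p, p \in pairs_of H -> h p.1 != h p.2.
  move=> hs; have s0 : 0 < s by have := leq_imsetT h; lia.
  have : ~~ cov s.-1 by apply/negP => /smin; lia.
  rewrite negb_exists => /forallP/(_ (finfun h)).
  have -> : finfun h @: [set: T] = h @: [set: T] by apply: eq_imset => x; rewrite ffunE.
  rewrite (_ : N <= _); last by lia.
  rewrite negb_forall_in => /exists_inP[H HA nH]; exists H => // p pH.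
  apply: contra nH => e; apply/exists_inP; exists p => //.
  by rewrite !ffunE.
(* For [s <= 1] the kernel of [g] has at most one edge, which all members would contain, against
   [nostar]. *)
have s2 : 1 < s.
  rewrite ltnNge; apply/negP => s1.
  have kp : #|ker_pairs g| <= 2.
    by apply: (@card_ker_pairs _ _ _ 1); rewrite (leq_trans gN) // leq_add2l.
  have hit F : F \in A -> exists2 p, p \in ker_pairs g & p \in pairs_of F.
    move=> /gA/exists_inP[p pF gp]; exists p => //; rewrite inE gp andbT.
    by move: pF; rewrite inE => /andP[].
  have [p pg _] := hit _ F0A.
  have pn : p.1 != p.2 by move: pg; rewrite inE => /andP[].
  have [F FA /negP[]] := nostar _ _ pn.
  have [q qg qF] := hit _ FA.
  have : q \in [set p; (p.2, p.1)].
    suff -> : [set p; (p.2, p.1)] = ker_pairs g by [].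
    apply/eqP; rewrite eqEcard; apply/andP; split.
      by apply/subsetP => z /set2P[]-> //; move: pg; rewrite !inE /= eq_sym (eq_sym (g p.1)).
    apply: leq_trans kp _; rewrite cards2; case: eqVneq => // e.
    by move: pn; rewrite [in X in X == _]e eqxx.
  move: qF; rewrite inE => /andP[_ t] /set2P[] e; rewrite e in t => //.
  by rewrite togC.
(* A rank below [s] is excluded by [trans], as [g] meets every member. *)
have eN : N = #|g @: [set: T]| + s.
  apply/eqP; rewrite eqn_leq gN /= leqNgt; apply/negP => /trans[H HA nH].
  by have /exists_inP[p /nH/negP] := gA _ HA.
pose f0 (x : T) := [set x].
have f0T : #|f0 @: [set: T]| = N by rewrite card_imset ?cardsT //; apply: set1_inj.
have N0 : 0 < N by lia.
(* Branching starts at the atom of the edge [p], of rank 1, which leaves [s.-1] steps. *)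
have cover p : p \in ker_pairs g ->
    7 ^ s.-1 * #|[set F in A | p \in pairs_of F]| <= 2 ^ s.-1 * st N.-1 (N - k).
  rewrite inE => /andP[pn _]; have := @card_glue _ _ f0 p.
  rewrite f0T (inj_eq set1_inj) => /(_ pn) eg.
  have eg' : #|glue f0 p @: [set: T]| = N.-1 by rewrite eg.
  rewrite -eg'; apply: leq_trans (branching sA mA light trans _); last by lia.
  rewrite leq_mul2l; apply/orP; right; apply: subset_leq_card.
  apply: subset_trans (above_glue _ _ pA); apply/subsetP => F.
  rewrite !inE => /andP[FA pF]; rewrite FA pF andbT; apply/coarserP => x y xT _.
  by move=> /set1_inj <-; apply: tog_refl (pA _ FA) xT.
have dc : 2 * #|A| <= \sum_(p in ker_pairs g) #|[set F in A | p \in pairs_of F]|.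
  apply: double_count => F FA; have /exists_inP[p pF gp] := gA _ FA.
  apply: (@card_symmetric_pairs _ _ p).
  - move=> q; rewrite !inE /= (eq_sym (g q.1)) (togC F) eq_sym.
    by move=> /andP[-> ->].
  - by move=> q; rewrite !inE => /andP[/andP[]].
  - rewrite inE pF andbT inE gp andbT.
    by move: pF; rewrite inE => /andP[].
have main : 7 ^ s.-1 * (2 * #|A|) <= s * s.+1 * (2 ^ s.-1 * st N.-1 (N - k)).
  apply: leq_trans (leq_mul (leqnn _) dc) _; rewrite big_distrr /=.
  apply: leq_trans (leq_sum _ cover) _; rewrite sum_nat_const leq_mul2r.
  by rewrite card_ker_pairs ?orbT // eN.
(* The factor [(s * s.+1 / 2) (2/7)^(s-1)] is exactly 6/7 at [s = 2] and decreases from there. *)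
have num : 7 * (s * s.+1) * 2 ^ s.-1 <= 12 * 7 ^ s.-1.
  case: s s2 {smin gN trans eN main cover} => [|[|s]] // _; elim: s => [|s IHs] //.
  rewrite /= in IHs *; rewrite !(expnS _ s.+1).
  move: (2 ^ s.+1) (7 ^ s.+1) IHs => a b IH.
  have : s.+3 * s.+4 * 2 * a <= 7 * (s.+2 * s.+3) * a by rewrite leq_mul2r; apply/orP; right; nia.
  lia.
have p7 : 0 < 7 ^ s.-1 by rewrite expn_gt0.
rewrite -(leq_pmul2l (_ : 0 < 2 * 7 ^ s.-1)) ?muln_gt0 //.
have : 7 * (s * s.+1) * 2 ^ s.-1 * st N.-1 (N - k) <= 12 * 7 ^ s.-1 * st N.-1 (N - k).
  by rewrite leq_mul2r num orbT.
lia.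
Qed.

Lemma pairs_of_ker (P : {set {set T}}) :
  partition P [set: T] -> pairs_of P = ker_pairs (pblock P).
Proof.
move=> pP; apply/setP => p; rewrite !inE (tog_pblock _ _ pP); congr (_ && _).
by rewrite eq_pblock ?(partition_trivIset pP) // (cover_partition pP) inE.
Qed.

Lemma pblock_setT (P : {set {set T}}) :
  partition P [set: T] -> pblock P @: [set: T] = P.
Proof.
move=> pP; apply/setP => B; apply/imsetP/idP => [[x _ ->]|BP].
  by apply: pblock_mem; rewrite (cover_partition pP) inE.
have /set0Pn[x xB] := partition_neq0 pP BP; exists x => //.
by rewrite (def_pblock (partition_trivIset pP) BP xB).
Qed.

Lemma card_pairs_of P : P \in flatk -> #|pairs_of P| <= k * k.+1.
Proof.
rewrite inE => /andP[pP /eqP cP]; rewrite pairs_of_ker //; apply: card_ker_pairs.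
by rewrite pblock_setT // cP; lia.
Qed.

(* Each [F] has at least [E - r * r.+1 >= E / 2] pairs outside the kernel of [f], of
   rank [r]: gluing any of these is one step of the induction. *)
Lemma tail_bound (T' : finType) (f : T -> T') E j r d :
  14 * k <= E -> 2 * (j * j.+1) <= E -> r + d <= j.+1 ->
  N <= #|f @: [set: T]| + r ->
  8 ^ d * #|above [set F in flatk | E <= #|pairs_of F|] f| <=
  3 ^ d * st #|f @: [set: T]| (N - k).
Proof.
set B := [set F in _ | _] => kE jE.
have sB : B \subset flatk by apply/subsetP => F; rewrite inE => /andP[].
have pB F : F \in B -> partition F [set: T] by apply: flatk_partition.
elim: d f r => [|d IHd] f r rj rN; first by rewrite !mul1n card_above_le.
pose X := [set p : T * T | (p.1 != p.2) && (f p.1 != f p.2)].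
have cX : #|X| <= N * N.-1.
  rewrite -card_neq_pairs; apply: subset_leq_card; apply/subsetP => p.
  by rewrite !inE => /andP[].
have [q eq] : exists q, #|f @: [set: T]| = q.+1.
  have /card_gt0P[x _] : 0 < #|T| by lia.
  by exists #|f @: [set: T]|.-1; rewrite prednK //; apply/card_gt0P; exists (f x); rewrite imset_f.
have IH p : p \in X ->
    8 ^ d * #|[set F in above B f | p \in pairs_of F]| <= 3 ^ d * st q (N - k).
  rewrite inE => /andP[_ np]; have := card_glue np; rewrite eq => -[eg].
  rewrite eg; apply: leq_trans (IHd _ r.+1 _ _); try lia.
  by rewrite leq_mul2l (subset_leq_card (above_glue _ _ pB)) orbT.
have kf : #|ker_pairs f| <= j * j.+1.
  by apply: leq_trans (card_ker_pairs rN) _; apply: leq_mul; lia.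
have main : 8 ^ d * ((E - j * j.+1) * #|above B f|) <= #|X| * (3 ^ d * st q (N - k)).
  apply: (@leq_trans (\sum_(p in X) 3 ^ d * st q (N - k))); last by rewrite sum_nat_const.
  apply: leq_trans (leq_sum _ IH); rewrite -big_distrr leq_mul2l; apply/orP; right.
  apply: double_count => F; rewrite inE => /andP[+ _]; rewrite inE => /andP[_ EF].
  apply: (leq_trans (leq_sub EF kf)).
  rewrite leq_subLR; apply: leq_trans (leq_card_setU _ _); apply: subset_leq_card.
  by apply/subsetP => p; rewrite !inE => /andP[-> ->]; case: (f p.1 == _).
have hst : 49 * (N * N.-1) * st q (N - k) <= 128 * k * st q.+1 (N - k).
  by apply: st_pred_le_pairs => //; rewrite -eq leq_imsetT.
have {}main := leq_trans main (leq_mul cX (leqnn _)).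
(* Since [E - j * j.+1 >= E / 2 >= 7 * k], one step costs at most [(128 * k / 49) / (7 * k) = 128 /
   343 < 3 / 8]. *)
rewrite eq !expnS -(leq_pmul2l (_ : 0 < 343 * k)) ?muln_gt0 //.
move: main hst; move: (8 ^ d) (3 ^ d) (st q _) (st q.+1 _) (N * N.-1) #|_| => x y a b M c.
move=> main hst.
have h1 : x * (7 * k * c) <= x * ((E - j * j.+1) * c).
  by rewrite leq_mul2l leq_mul2r; apply/orP; right; apply/orP; right; lia.
have h2 : y * (49 * M * a) <= y * (128 * k * b) by rewrite leq_mul2l hst orbT.
lia.
Qed.

Lemma st_star_gt0 : 0 < st N.-1 (N - k).
Proof.
have -> : N.-1 = N - k + k.-1 by lia.
by apply: st_gt0; lia.
Qed.

(** As [H] has the fewest edges, every member passes the threshold [E] of [tail_bound]. Every member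
    meets [H], so the bound is summed over the pairs of [H]. *)
Lemma heavy_bound A H :
  A \subset flatk -> meeting A -> H \in A -> 14 * k < #|pairs_of H| ->
  (forall F, F \in A -> #|pairs_of H| <= #|pairs_of F|) ->
  exists j, [/\ 9 <= j, j + 2 <= k, #|pairs_of H| < 2 * (j.+1 * j.+2) &
    4 ^ j.+1 * #|A| < 3 ^ j.+1 * st N.-1 (N - k)].
Proof.
move=> sA mA HA; move eE : #|pairs_of H| => E kE Emin.
have Ek : E <= k * k.+1 by rewrite -eE card_pairs_of // (subsetP sA).
have pA F : F \in A -> partition F [set: T] by apply: flatk_partition.
have ex : exists j, 2 * (j * j.+1) <= E by exists 0.
have bd j : 2 * (j * j.+1) <= E -> j <= E by nia.
(* The largest [j] allowed in [tail_bound]. From [14 * k < E <= k * k.+1] follows [k >= 14], so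
   [E > 196] and [j >= 9]. *)
case: (ex_maxnP ex bd) => j jE jmax.
have Ej : E < 2 * (j.+1 * j.+2) by rewrite ltnNge; apply/negP => /jmax; lia.
have k14 : 14 <= k by nia.
have j9 : 9 <= j by nia.
have jk : j + 2 <= k by rewrite leqNgt; apply/negP => h; nia.
exists j; split=> //.
pose B := [set F in flatk | E <= #|pairs_of F|].
pose f0 (x : T) := [set x].
have f0T : #|f0 @: [set: T]| = N by rewrite card_imset ?cardsT //; apply: set1_inj.
have cover p : p \in pairs_of H ->
    8 ^ j * #|[set F in A | p \in pairs_of F]| <= 3 ^ j * st N.-1 (N - k).
  rewrite inE => /andP[pn _]; have := @card_glue _ _ f0 p.
  rewrite f0T (inj_eq set1_inj) => /(_ pn) eg.
  have eg' : #|glue f0 p @: [set: T]| = N.-1 by rewrite eg.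
  rewrite -eg'; apply: leq_trans (tail_bound (E := E) (j := j) (r := 1) _ _ _ _); try lia.
  rewrite leq_mul2l; apply/orP; right; apply: subset_leq_card.
  apply: subset_trans (above_glue _ _ _); last first.
    by move=> F; rewrite !inE -andbA => /and3P[].
  apply/subsetP => F; rewrite !inE => /and3P[FA -> ->]; rewrite andbT.
  have := subsetP sA _ FA; rewrite inE => ->; rewrite Emin //.
  rewrite !andbT /=; apply/coarserP => x y xT _.
  by move=> /set1_inj <-; apply: tog_refl (pA _ FA) xT.
have dc : 2 * #|A| <= \sum_(p in pairs_of H) #|[set F in A | p \in pairs_of F]|.
  apply: double_count => F FA; have [p pH pF] := mA _ _ HA FA.
  exact: card_meet_pairs pH pF.
have main : 8 ^ j * (2 * #|A|) <= E * (3 ^ j * st N.-1 (N - k)).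
  apply: leq_trans (leq_mul (leqnn _) dc) _; rewrite big_distrr /=.
  by apply: leq_trans (leq_sum _ cover) _; rewrite sum_nat_const eE.
(* This yields [(E / 2) (3/8)^j < (j+1)(j+2) (3/8)^j <= (3/4)^(j+1)]; the induction starts at
   [j = 9]. *)
have num : 4 * (j.+1 * j.+2) <= 3 * 2 ^ j.
  have -> : j = j - 9 + 9 by lia.
  elim: (j - 9) => [|i IHi] //; rewrite addSn expnS; nia.
have S0 := st_star_gt0; have p3 : 0 < 3 ^ j by rewrite expn_gt0.
have p2 : 0 < 2 ^ j by rewrite expn_gt0.
rewrite -(ltn_pmul2l p2) !expnS.
have e8 : 8 ^ j = 2 ^ j * 4 ^ j by rewrite -expnMn.
rewrite e8 in main.
have lt : E * (3 ^ j * st N.-1 (N - k)) < 2 * (j.+1 * j.+2) * (3 ^ j * st N.-1 (N - k)).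
  by rewrite ltn_pmul2r // muln_gt0 p3.
have le : 4 * (j.+1 * j.+2) * (3 ^ j * st N.-1 (N - k)) <=
          3 * 2 ^ j * (3 ^ j * st N.-1 (N - k)) by rewrite leq_mul2r num orbT.
lia.
Qed.

End Families.

(** * Inequalities of Bernoulli type *)

Lemma leq_expl a b n : a <= b -> a ^ n <= b ^ n.
Proof. by case: n => // n ab; rewrite leq_exp2r. Qed.

(** Bernoulli's inequality for [1 + 1/a], cleared of denominators. *)
Lemma bernoulli_up a n : a ^ n * (a + n) <= a.+1 ^ n * a.
Proof.
elim: n => [|n IHn]; first by rewrite !mul1n addn0.
rewrite !expnS; move: (a ^ n) (a.+1 ^ n) IHn => u w h.
apply: (@leq_trans (a.+1 * (u * (a + n)))); last by rewrite -mulnA leq_mul2l h orbT.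
nia.
Qed.

(** Bernoulli's inequality for [1 - 1/(a+1)]; it is trivial where the subtraction truncates. *)
Lemma bernoulli_down a n : a.+1 ^ n * (a.+1 - n) <= a ^ n * a.+1.
Proof.
elim: n => [|n IHn]; first by rewrite subn0 !mul1n.
rewrite !expnS; move: (a ^ n) (a.+1 ^ n) IHn => u w h.
apply: (@leq_trans (a * (w * (a.+1 - n)))); last by rewrite -mulnA leq_mul2l h orbT.
have [le|lt] := leqP a n; first by rewrite (_ : a.+1 - n.+1 = 0) ?muln0 //; lia.
have [c ->] : exists c, a = n.+1 + c by exists (a - n.+1); lia.
have -> : (n.+1 + c).+1 - n.+1 = c.+1 by lia.
have -> : (n.+1 + c).+1 - n = c.+2 by lia.
nia.
Qed.

(** Excluding [d] of [M] blocks keeps the fraction [1 - d/M]. The loss is charged to [2 * d] ordered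
    pairs, at a factor [1 - 1/(8k)] each. *)
Lemma insertion_loss k M d : 0 < k -> d <= k -> 5 * k <= M ->
  (8 * k).-1 ^ (2 * d) * M <= (8 * k) ^ (2 * d) * (M - d).
Proof.
move=> k0 dk kM; have eb : 8 * k = (8 * k).-1.+1 by lia.
have := bernoulli_up (8 * k).-1 (2 * d); rewrite -eb.
move ea : (8 * k).-1 => a h; rewrite -(leq_pmul2r (_ : 0 < a)); last by lia.
move: h; move: (a ^ _) ((8 * k) ^ _) => u w h.
have h2 : u * (a + 2 * d) * (M - d) <= w * a * (M - d) by rewrite leq_mul2r h orbT.
(* For [d > 0] this amounts to [a <= 2 * (M - d)], where [M - d >= 4 * k] and [a < 8 * k]. *)
have h3 : a * M <= (a + 2 * d) * (M - d).
  have [c ec] : exists c, M = d + c by exists (M - d); lia.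
  rewrite ec addKn; nia.
have : u * (a * M) <= u * ((a + 2 * d) * (M - d)) by rewrite leq_mul2l h3 orbT.
lia.
Qed.

Lemma cardsC_insert (T : finType) (D : {set T}) v :
  v \notin D -> #|~: D| = #|~: (v |: D)|.+1.
Proof. by move=> vD; have := cardsC D; have := cardsC (v |: D); rewrite cardsU1 vD; lia. Qed.

(** * Flats above an edge that are disjoint from a given flat *)

Section Missing.

Variables (T : finType) (k : nat).
Hypotheses (k_gt0 : 0 < k) (leT : 8 * k <= #|T|).
Local Notation N := #|T|.
Local Notation flatk := (parts [set: T] (N - k)).

Variables (H : {set {set T}}) (x y : T).
Hypotheses (flatH : H \in flatk) (nxy : x != y) (nHxy : ~~ tog H x y).

Definition avoiding (P : {set {set T}}) : bool :=
  tog P x y && [forall p in pairs_of H, ~~ tog P p.1 p.2].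

Let partH : partition H [set: T].
Proof. by move: flatH; rewrite inE => /andP[]. Qed.

Let f := pblock H.

Let fE u v : (f u == f v) = tog H u v.
Proof.
rewrite (tog_pblock _ _ partH) eq_pblock ?(partition_trivIset partH) //.
by rewrite (cover_partition partH) inE.
Qed.

(** [x] and [y] represent their own blocks, so that both lie in the transversal. The default of
    [odflt] is never reached, as [z] is together with itself. *)
Definition representative (z : T) : T :=
  if tog H z x then x else if tog H z y then y
  else odflt x [pick w | tog H w z].

Local Notation r := representative.

Let f_rep z : f (r z) = f z.
Proof.
rewrite /r; have [t|_] := boolP (tog H z x); first by apply/eqP; rewrite fE togC.
have [t|_] := boolP (tog H z y); first by apply/eqP; rewrite fE togC.
case: pickP => [w t|/(_ z)] /=; first by apply/eqP; rewrite fE.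
by rewrite (tog_refl partH).
Qed.

Let rep_eq u v : f u = f v -> r u = r v.
Proof.
move=> e; have te w : tog H u w = tog H v w by rewrite -!fE e.
have te' w : tog H w u = tog H w v by rewrite !(togC H w).
by rewrite /r !te (eq_pick te').
Qed.

(* One vertex per block of [H], including [x] and [y]: vertices outside are
   inserted last, when there are already at least [5 * k] blocks. *)
Definition transv : {set T} := r @: [set: T].

Let xD : x \in transv.
Proof. by apply/imsetP; exists x; rewrite // /r (tog_refl partH). Qed.

Let yD : y \in transv.
Proof.
by apply/imsetP; exists y; rewrite // /r (togC H y x) (negPf nHxy) (tog_refl partH).
Qed.

Let transv_sep u v : u \in transv -> v \in transv -> tog H u v -> u = v.
Proof.
case/imsetP => u' _ -> /imsetP[v' _ ->]; rewrite -fE !f_rep => /eqP.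
exact: rep_eq.
Qed.

Let card_transv : #|~: transv| <= k.
Proof.
have : #|f @: [set: T]| <= #|transv|.
  apply: leq_trans (leq_imset_card f _); apply: subset_leq_card.
  apply/subsetP => _ /imsetP[z _ ->]; rewrite -f_rep; apply: imset_f.
  exact: imset_f.
rewrite pblock_setT //; move: flatH; rewrite inE => /andP[_ /eqP ->].
by have := cardsC transv; lia.
Qed.

Definition inner_pairs (D : {set T}) : {set T * T} :=
  [set p in pairs_of H | (p.1 \in D) && (p.2 \in D)].

Definition mates (D : {set T}) (v : T) : {set T} :=
  [set u in D | (v != u) && tog H v u].

Let card_mates D v : #|mates D v| <= k.
Proof.
have := card_fiber f v; rewrite pblock_setT //.
have -> : N - #|H| = k by move: flatH; rewrite inE => /andP[_ /eqP ->]; lia.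
rewrite (cardsD1 v) inE eqxx ltnS; apply: leq_trans.
apply: subset_leq_card; apply/subsetP => u.
by rewrite !inE => /and3P[_ n t]; rewrite eq_sym n fE togC.
Qed.

(** Each mate of [v] adds one edge, whose two orders are collected in [L] and [R]. *)
Let card_inner (D : {set T}) v : v \notin D ->
  #|inner_pairs (v |: D)| = #|inner_pairs D| + 2 * #|mates D v|.
Proof.
move=> vD; pose L := [set (v, u) | u in mates D v]; pose R := [set (u, v) | u in mates D v].
have cL : #|L| = #|mates D v| by rewrite card_imset // => a b [].
have cR : #|R| = #|mates D v| by rewrite card_imset // => a b [].
have nv u : u \in D -> u != v by apply: contraTneq => ->.
have -> : inner_pairs (v |: D) = inner_pairs D :|: (L :|: R).
  apply/setP => -[a b]; rewrite !inE /=; apply/idP/idP.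
    case/andP=> /andP[n t] /andP[/orP[/eqP ea|aD] /orP[/eqP eb|bD]].
    - by rewrite ea eb eqxx in n.
    - apply/orP; right; apply/orP; left; apply/imsetP; exists b; rewrite ?ea // !inE bD.
      by rewrite -ea n.
    - apply/orP; right; apply/orP; right; apply/imsetP; exists a; rewrite ?eb // !inE aD.
      by rewrite -eb eq_sym n togC.
    - by rewrite n t aD bD.
  case/orP => [/andP[-> /andP[-> ->]]|]; first by rewrite !orbT.
  case/orP => /imsetP[u]; rewrite !inE => /and3P[uD n t] [-> ->].
    by rewrite n t eqxx uD orbT.
  by rewrite eq_sym n togC t eqxx uD orbT.
rewrite !cardsU.
have -> : L :&: R = set0.
  apply/setP => p; rewrite !inE; apply/negP => /andP[/imsetP[u uM ->] /imsetP[w wM [e1 e2]]].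
  by move: uM; rewrite inE -e2 eqxx andbF.
have -> : inner_pairs D :&: (L :|: R) = set0.
  apply/setP => -[a b]; rewrite !inE; apply/negP => /andP[/andP[_ /andP[aD bD]]].
  by case/orP => /imsetP[u _ [ea eb]]; move: vD; rewrite /= in aD bD; rewrite -?ea -?eb ?aD ?bD.
rewrite !cards0 cL cR; lia.
Qed.

(** Distinct points of the transversal lie in different blocks of [H], so only [tog P x y] restricts
    [P]; the map [g] merges [y] into [x]. *)
Let base_count m :
  st #|transv|.-1 m <= #|[set P in parts transv m | avoiding P]|.
Proof.
pose g z := if z == y then x else z.
have eg : #|g @: transv| = #|transv|.-1.
  rewrite (cardsD1 y transv) yD add1n /=; apply: eq_card => z; rewrite !inE.
  apply/imsetP/andP => [[w wD ->]|[zy zD]]; last by exists z; rewrite // /g (negPf zy).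
  by rewrite /g; case: (eqVneq w y) => [_|n]; [rewrite nxy xD|rewrite n wD].
rewrite -eg -card_coarser; apply: subset_leq_card; apply/subsetP => P.
rewrite !inE => /andP[/andP[pP ->] /coarserP h]; rewrite pP /=; apply/andP; split.
  by apply: h => //; rewrite /g eqxx (negPf nxy).
apply/forall_inP => p; rewrite inE => /andP[n t]; apply/negP => tP.
have /andP[p1 p2] := tog_dom pP tP.
by move: n; rewrite (transv_sep p1 p2 t) eqxx.
Qed.

(* A new point [v] may join any block except those holding one of its mates. *)
Let insert_count (D : {set T}) v m :
  x \in D -> y \in D -> v \notin D ->
  #|[set P in parts D m | avoiding P]| +
  (m.+1 - #|mates D v|) * #|[set P in parts D m.+1 | avoiding P]| <=
  #|[set P in parts (v |: D) m.+1 | avoiding P]|.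
Proof.
move=> xD' yD' vD; rewrite card_parts_insert //.
have nv u : u \in D -> u != v by apply: contraTneq => ->.
apply: leq_add.
  apply: subset_leq_card; apply/subsetP => P.
  rewrite !inE => /andP[-> /andP[t /forall_inP h]] /=; apply/andP; split.
    by rewrite tog_ins1 t orbT.
  apply/forall_inP => p pH; rewrite tog_ins1 negb_or h // andbT.
  by move: pH; rewrite inE; apply: contraL => /andP[/eqP-> /eqP->]; rewrite eqxx.
rewrite mulnC -sum_nat_const.
rewrite [X in _ <= X](big_setID [set P | avoiding P]) /=.
apply: leq_trans (leq_addr _ _).
rewrite [X in _ <= X](eq_bigl [in [set P in parts D m.+1 | avoiding P]]); last first.
  by move=> P; rewrite !inE.
apply: leq_sum => P; rewrite !inE => /andP[/andP[pP /eqP cP] /andP[t /forall_inP h]].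
(* The excluded blocks are those of the mates, at most one for each mate. *)
rewrite leq_subLR -cP.
apply: leq_trans (leq_add (leq_imset_card (pblock P) (mates D v)) (leqnn _)).
apply: leq_trans (leq_card_setU _ _); apply: subset_leq_card; apply/subsetP => B BP.
rewrite in_setU; have [//|nB] := boolP (B \in _).
rewrite inE BP /=; apply/andP; split; first by rewrite tog_ins_neq ?nv.
have new u : (v != u) && tog H v u -> ~~ tog (ins v P B) v u.
  case/andP=> n tH; rewrite (tog_ins_new _ vD pP BP) !inE eq_sym (negPf n) /=.
  apply: contra nB => uB; apply/imsetP; exists u.
    by rewrite inE n tH (subsetP (partitionS pP BP)).
  by rewrite (def_pblock (partition_trivIset pP) BP uB).
apply/forall_inP => -[a b] pH /=; have := pH; rewrite inE /= => /andP[n tH].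
have [ea|na] := eqVneq a v; first by subst a; apply: new; rewrite n.
have [eb|nb] := eqVneq b v; first by subst b; rewrite togC; apply: new; rewrite eq_sym n togC.
by rewrite tog_ins_neq // (h _ pH).
Qed.

(** The vertex set grows from the transversal, where nothing is lost, to all of [T]. Each insertion
    loses at most a factor [1 - 1/(8k)] per ordered pair of [H] that becomes internal, and at the
    end these are all of [pairs_of H]. *)
Lemma card_avoiding_ge :
  (8 * k).-1 ^ #|pairs_of H| * st N.-1 (N - k) <=
  (8 * k) ^ #|pairs_of H| * #|[set F in flatk | avoiding F]|.
Proof.
(* [c] counts the inserted vertices. At most [k] vertices lie outside [D], so the lower bound on [m]
   provides the [5 * k] blocks that [insertion_loss] asks for. *)
have key c (D : {set T}) m : transv \subset D -> #|D| = #|transv| + c ->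
    N - k <= m + #|~: D| ->
    (8 * k).-1 ^ #|inner_pairs D| * st #|D|.-1 m <=
    (8 * k) ^ #|inner_pairs D| * #|[set P in parts D m | avoiding P]|.
  elim: c D m => [|c IHc] D m sD cD mD.
    have eD : transv = D by apply/eqP; rewrite eqEcard sD cD addn0 leqnn.
    subst D; rewrite (_ : inner_pairs transv = set0) ?cards0 ?mul1n; first exact: base_count.
    apply/setP => p; rewrite !inE; apply/negP => /andP[/andP[n t] /andP[p1 p2]].
    by move: n; rewrite (transv_sep p1 p2 t) eqxx.
  have /subsetPn[v vD vt] : ~~ (D \subset transv).
    by apply/negP => /subset_leq_card; lia.
  have [D' eD vD'] : exists2 D', D = v |: D' & v \notin D'.
    by exists (D :\ v); rewrite ?setD1K // !inE eqxx.
  subst D; have sD' : transv \subset D'.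
    apply/subsetP => z zt; have := subsetP sD z zt; rewrite !inE => /orP[/eqP ez|//].
    by rewrite -ez zt in vt.
  have cD' : #|D'| = #|transv| + c by move: cD; rewrite cardsU1 vD' add1n addnS => -[].
  have xD' := subsetP sD' _ xD; have yD' := subsetP sD' _ yD.
  have cC : #|~: D'| = #|~: (v |: D')|.+1.
    exact: cardsC_insert.
  have kC : #|~: (v |: D')| <= k.
    by apply: leq_trans card_transv; rewrite subset_leq_card // setCS.
  case: m mD => [|m] mD; first by clear -mD kC k_gt0 leT; lia.
  have ih1 := IHc D' m sD' cD' ltac:(clear -mD cC; lia).
  have ih2 := IHc D' m.+1 sD' cD' ltac:(clear -mD cC; lia).
  rewrite card_inner // (expnD (8 * k).-1) (expnD (8 * k)).
  have [n en] : exists n, #|D'| = n.+1.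
    by exists #|D'|.-1; rewrite prednK //; apply/card_gt0P; exists x.
  rewrite cardsU1 vD' add1n succnK en /= in ih1 ih2 *.
  have ins := insert_count m xD' yD' vD'.
  have loss := insertion_loss k_gt0 (card_mates D' v) (_ : 5 * k <= m.+1).
  have {}loss : _ := loss ltac:(clear -mD kC k_gt0 leT; lia).
  have ple : (8 * k).-1 ^ (2 * #|mates D' v|) <= (8 * k) ^ (2 * #|mates D' v|).
    exact/leq_expl/leq_pred.
  apply: leq_trans (leq_mul (leqnn _) ins).
  move: ih1 ih2 loss ple.
  move: ((8 * k).-1 ^ #|inner_pairs D'|) ((8 * k) ^ #|inner_pairs D'|).
  move: ((8 * k).-1 ^ (2 * _)) ((8 * k) ^ (2 * _)).
  move: (st n m) (st n m.+1) #|[set P in parts D' m | avoiding P]|.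
  move: #|[set P in parts D' m.+1 | avoiding P]| => g2 s1 s2 g1 a' b' a b ih1 ih2 loss ple.
  (* In [e1] the vertex [v] is a singleton block and nothing is lost; in [e2] it joins an old block,
     at the cost of [loss]. *)
  have e1 : a * s1 * a' <= b * g1 * b' by rewrite leq_mul.
  have e2 : a * s2 * (a' * m.+1) <= b * g2 * (b' * (m.+1 - #|mates D' v|)) by rewrite leq_mul.
  have := leq_add e1 e2; move: (m.+1 - _) => d; clear; lia.
have := key (N - #|transv|) [set: T] (N - k).
rewrite subsetT cardsT setCT cards0 addn0 subnKC ?max_card // => /(_ isT erefl (leqnn _)).
by rewrite (_ : inner_pairs _ = pairs_of H) //; apply/setP => p; rewrite !inE !andbT.
Qed.

(** As [j + 2 <= k], Bernoulli gives [(1 - 1/(8k))^(2(j+2)) >= 1 - 2(j+2)/(8k) >= 3/4]. The power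
    [j.+1] of this has exponent [W] on the left. *)
Lemma card_avoiding_ge_pow j : j + 2 <= k -> #|pairs_of H| <= 2 * (j.+1 * j.+2) ->
  3 ^ j.+1 * st N.-1 (N - k) <= 4 ^ j.+1 * #|[set F in flatk | avoiding F]|.
Proof.
move=> jk; set W := 2 * _ => EW; have := card_avoiding_ge.
move: #|pairs_of H| EW => E EW main.
have eb : 8 * k = (8 * k).-1.+1 by lia.
(* Padding with [W - E] further factors below 1 only weakens the bound. *)
have ab : (8 * k).-1 ^ (W - E) <= (8 * k) ^ (W - E) by exact/leq_expl/leq_pred.
have {main} := leq_mul main ab.
rewrite mulnAC [X in _ <= X]mulnAC -!expnD subnKC // => main.
have b1 : 3 * (8 * k) ^ (2 * j.+2) <= 4 * (8 * k).-1 ^ (2 * j.+2).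
  have := bernoulli_down (8 * k).-1 (2 * j.+2); rewrite -eb.
  move: ((8 * k) ^ _) ((8 * k).-1 ^ _) => w u h.
  rewrite -(leq_pmul2r (_ : 0 < 2 * k)) ?muln_gt0 //.
  apply: leq_trans (leq_trans h _); last by lia.
  rewrite -mulnA mulnC -mulnA leq_mul2l; apply/orP; right; lia.
have : (3 * (8 * k) ^ (2 * j.+2)) ^ j.+1 <= (4 * (8 * k).-1 ^ (2 * j.+2)) ^ j.+1.
  by rewrite leq_exp2r.
rewrite (expnMn 3) (expnMn 4) -!expnM (_ : 2 * j.+2 * j.+1 = W); last by rewrite /W; lia.
move=> h.
have b0 : 0 < (8 * k) ^ W by rewrite expn_gt0 muln_gt0 k_gt0.
rewrite -(leq_pmul2l b0).
move: main h; move: ((8 * k).-1 ^ W) ((8 * k) ^ W) (3 ^ _) (4 ^ _) (st _ _) #|_|.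
move=> a b c3 c4 s g main h.
have h1 : c3 * b * s <= c4 * a * s by rewrite leq_mul2r h orbT.
have h2 : c4 * (a * s) <= c4 * (b * g) by rewrite leq_mul2l main orbT.
lia.
Qed.

End Missing.

(** * The theorem *)

(** For [x != y] the kernel is the atom with single edge [xy], so that [card_coarser] counts the
    flats above that edge. *)
Definition join_pair (T : finType) (x y : T) : T -> {set T} :=
  glue (fun z => [set z]) (x, y).

Lemma card_join_pair (T : finType) (x y : T) :
  x != y -> #|join_pair x y @: [set: T]| = #|T|.-1.
Proof.
move=> nxy; have := @card_glue _ _ (fun z : T => [set z]) (x, y).
by rewrite card_imset ?cardsT ?(inj_eq set1_inj) => [/(_ nxy) ->|]; last exact: set1_inj.
Qed.

Lemma coarser_join_pair (T : finType) (x y : T) (F : {set {set T}}) :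
  partition F [set: T] -> coarser (join_pair x y) [set: T] F = tog F x y.
Proof.
move=> pF; apply/coarserP/idP => [h|t u v _ _].
  apply: h; rewrite ?inE // /join_pair /glue /= eqxx.
  by case: eqVneq.
rewrite /join_pair /glue /= !(inj_eq set1_inj).
have tr z : tog F z z by apply: tog_refl pF (in_setT _).
case: (eqVneq u y) => [->|_]; case: (eqVneq v y) => [->|_] /set1_inj e.
- exact: tr.
- by rewrite -e togC.
- by rewrite e.
- by rewrite e.
Qed.

(** * Strict bound for families without a common edge *)

Section Star.

Variables (T : finType) (k : nat).
Hypotheses (k_gt0 : 0 < k) (leT : 8 * k <= #|T|).
Local Notation N := #|T|.
Local Notation flatk := (parts [set: T] (N - k)).
Implicit Types (A : {set {set {set T}}}).

Lemma card_star x y : x != y ->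
  #|[set F in flatk | tog F x y]| = st N.-1 (N - k).
Proof.
move=> nxy; rewrite -(card_join_pair nxy) -card_coarser; apply: eq_card => F.
rewrite [LHS]inE [RHS]inE; apply: andb_id2l; rewrite inE => /andP[pF _].
by rewrite coarser_join_pair.
Qed.

Lemma heavy_family A : A \subset flatk -> meeting A -> A != set0 ->
  (forall F, F \in A -> 14 * k < #|pairs_of F|) ->
  exists H j, [/\ H \in A, 9 <= j, j + 2 <= k,
    #|pairs_of H| < 2 * (j.+1 * j.+2) &
    4 ^ j.+1 * #|A| < 3 ^ j.+1 * st N.-1 (N - k)].
Proof.
move=> sA mA /set0Pn[H0 H0A] heavy.
case: (arg_minnP (fun F => #|pairs_of F|) H0A) => H HA Hmin.
have [j [j9 jk Ej main]] := heavy_bound k_gt0 leT sA mA HA (heavy _ HA) Hmin.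
by exists H, j.
Qed.

(** The 7 matches [light_bound], which leaves a seventh of a star to the heavy members. *)
Lemma heavy_small A : A \subset flatk -> meeting A ->
  (forall F, F \in A -> 14 * k < #|pairs_of F|) -> 7 * #|A| < st N.-1 (N - k).
Proof.
move=> sA mA heavy; have S0 := st_star_gt0 k_gt0 leT.
have [->|A0] := eqVneq A set0; first by rewrite cards0.
have [_ [j [_ j9 _ _ main]]] := heavy_family sA mA A0 heavy.
have num : 7 * 3 ^ j.+1 <= 4 ^ j.+1.
  (* As [(3/4)^3 = 27/64 < 1/2], nine factors [3/4] already give less than [1/8]. *)
  have -> : j.+1 = 3 * 3 + (j - 8) by lia.
  rewrite (expnD 3 (3 * 3)) (expnD 4 (3 * 3)) mulnA.
  apply: leq_mul; last exact: leq_expl.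
  rewrite !(expnM _ 3 3).
  apply: (@leq_trans (2 ^ 3 * (3 ^ 3) ^ 3)); first by rewrite leq_mul2r orbT.
  by rewrite -expnMn leq_exp2r.
have p4 : 0 < 4 ^ j.+1 by rewrite expn_gt0.
rewrite -(ltn_pmul2l p4).
have : 7 * 3 ^ j.+1 * st N.-1 (N - k) <= 4 ^ j.+1 * st N.-1 (N - k).
  by rewrite leq_mul2r num orbT.
by move: main; clear; lia.
Qed.

Lemma nonstar_bound A : A \subset flatk -> meeting A ->
  (forall x y, x != y -> exists2 F, F \in A & ~~ tog F x y) ->
  #|A| < st N.-1 (N - k).
Proof.
move=> sA mA nostar; pose L := [set F in A | #|pairs_of F| <= 14 * k].
have sub (B : {set {set {set T}}}) : B \subset A -> B \subset flatk /\ meeting B.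
  move=> BA; split; first exact: subset_trans sA.
  by move=> P Q PB QB; apply: mA; apply: (subsetP BA).
have LA : L \subset A by apply/subsetP => F; rewrite inE => /andP[].
have [sL mL] := sub _ LA; have [sH mH] := sub _ (subsetDl A L).
have eA : #|A| = #|L| + #|A :\: L| by rewrite -(cardsID L A) (setIidPr LA).
have hH F : F \in A :\: L -> 14 * k < #|pairs_of F|.
  by rewrite !inE => /andP[+ FA]; rewrite FA /= -ltnNge.
have small := heavy_small sH mH hH.
have [L0|L0] := eqVneq L set0.
  by move: small; rewrite eA L0 cards0; clear; lia.
have [/existsP[[x y] /andP[/= nxy /forall_inP common]]|none] :=
    boolP [exists p : T * T, (p.1 != p.2) && [forall F in L, tog F p.1 p.2]]; last first.
  have lb : 7 * #|L| <= 6 * st N.-1 (N - k).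
    apply: (light_bound k_gt0 leT sL mL L0) => [F|x y nxy]; first by rewrite inE => /andP[].
    move: none; rewrite negb_exists => /forallP/(_ (x, y)); rewrite nxy /=.
    by rewrite negb_forall_in => /exists_inP.
  by move: small lb; rewrite eA; clear; lia.
(* All light members contain [xy], so the members in [M] are heavy. *)
pose S := [set F in A | tog F x y]; pose M := A :\: S.
have MA : M \subset A by apply: subsetDl.
have [sM mM] := sub _ MA.
have hM F : F \in M -> 14 * k < #|pairs_of F|.
  rewrite !inE => /andP[+ FA]; rewrite FA /= ltnNge => nt.
  by apply: contra nt => lF; apply: common; rewrite inE FA.
have M0 : M != set0.
  by have [F FA nt] := nostar _ _ nxy; apply/set0Pn; exists F; rewrite !inE FA andbT.
have [H [j [HM j9 jk Ej main]]] := heavy_family sM mM M0 hM.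
have HA := subsetP MA _ HM.
have nH : ~~ tog H x y by move: HM; rewrite !inE HA andbT.
have av := card_avoiding_ge_pow k_gt0 leT (subsetP sA _ HA) nxy nH jk (ltnW Ej).
(* The part of the star of [xy] that is disjoint from [H], and therefore missing from [A]. *)
pose V := [set F in flatk | avoiding H x y F].
have dis : S :&: V = set0.
  apply/setP => F; rewrite in_setI [F \in S]inE [F \in V]inE in_set0.
  apply/negP => /andP[/andP[FA _] /andP[_ /andP[_ /forall_inP h]]].
  have [p pH] := mA _ _ HA FA; rewrite inE => /andP[_ t].
  by have := h _ pH; rewrite t.
have SV : #|S| + #|V| <= st N.-1 (N - k).
  rewrite -(card_star nxy).
  have := cardsU S V; rewrite dis cards0 subn0 => <-; apply: subset_leq_card.
  apply/subsetP => F; rewrite in_setU [F \in S]inE [F \in V]inE.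
  rewrite [F \in [set _ in _ | tog _ _ _]]inE.
  by case/orP => [/andP[/(subsetP sA) -> ->]|/andP[-> /andP[-> _]]].
(* Both estimates share [j]: [M] stays below [(3/4)^(j+1)] of a star, and [V] reaches it. *)
have lt : #|M| < #|V|.
  by rewrite -(ltn_pmul2l (_ : 0 < 4 ^ j.+1)) ?expn_gt0 // (leq_trans main).
rewrite -(cardsID S A) (setIidPr _); last by apply/subsetP => F; rewrite inE => /andP[].
by rewrite -/M (leq_trans _ SV) // ltn_add2l.
Qed.

End Star.

(** * Translation from flats and atoms to partitions and pairs *)

Lemma flats_of_rankE n k : 0 < k <= n.+1 ->
  flats_of_rank n k = parts [set: 'I_n.+1] (n.+1 - k).
Proof.
move=> kn; apply/setP => P; rewrite !inE /rk; congr (_ && _).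
by apply/eqP/eqP; lia.
Qed.

(** Without a common pair all blocks of the meet have at most one element, so there are at least
    [n.+1] of them and the rank is 0. *)
Lemma intersecting_meeting n (A : {set {set {set 'I_n.+1}}}) :
  A \subset flats n -> intersecting A -> meeting A.
Proof.
move=> sA [_ iA] P Q PA QA.
have fP := subsetP sA _ PA; have fQ := subsetP sA _ QA.
have := flat_meet_flat fP fQ; rewrite inE => pM.
have [/existsP[p /andP[pP pQ]]|none] :=
  boolP [exists p, (p \in pairs_of P) && (p \in pairs_of Q)]; first by exists p.
have := iA _ _ PA QA; rewrite /rk subn_gt0 ltnNge => /negP[].
have := card_partition pM; rewrite cardsT card_ord => /eq_leq e.
apply: leq_trans e _; rewrite -sum1_card; apply: leq_sum => D.
rewrite !inE => /andP[_ /imset2P[B C BP CQ ->]].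
rewrite leqNgt; apply: contra none => /card_gt1P[x [y]].
rewrite !inE => -[/andP[xB xC] /andP[yB yC] nxy]; apply/existsP; exists (x, y).
by rewrite !inE /= nxy; apply/andP; split; apply/exists_inP; [exists B|exists C]; rewrite ?xB ?xC.
Qed.

Lemma flat_le_coarser n (a F : {set {set 'I_n.+1}}) :
  a \in flats n -> F \in flats n ->
  flat_le a F = coarser (pblock a) [set: 'I_n.+1] F.
Proof.
rewrite !inE => pa pF.
apply/forall_inP/coarserP => [h u v _ _ e|h B Ba].
  have ua : u \in cover a by rewrite (cover_partition pa) inE.
  have va : v \in cover a by rewrite (cover_partition pa) inE.
  have /exists_inP[C CF sC] := h _ (pblock_mem ua).
  apply/exists_inP; exists C => //; rewrite !(subsetP sC) ?mem_pblock //.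
  by rewrite e mem_pblock.
have /set0Pn[x xB] := partition_neq0 pa Ba.
have xF : x \in cover F by rewrite (cover_partition pF) inE.
apply/exists_inP; exists (pblock F x); first exact: pblock_mem.
apply/subsetP => y yB; rewrite -(tog_pblock _ _ pF); apply: h; rewrite ?inE //.
by rewrite !(def_pblock (partition_trivIset pa) Ba).
Qed.

Lemma atom_of_pair n (x y : 'I_n.+1) : 0 < n -> x != y ->
  exists2 a, a \in atoms n &
    forall F, F \in flats n -> flat_le a F = tog F x y.
Proof.
move=> n0 nxy; pose g := join_pair x y; pose a := preim_partition g [set: 'I_n.+1].
have pa : partition a [set: 'I_n.+1] := preim_partitionP _ _.
have ka u v : (pblock a u == pblock a v) = (g u == g v).
  rewrite eq_pblock ?(partition_trivIset pa) // ?(cover_partition pa) ?inE //.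
  rewrite pblock_equivalence_partition ?inE //.
  by split=> // /eqP ->.
exists a.
  rewrite /atoms flats_of_rankE // inE pa /= -(pblock_setT pa).
  (* The blocks of [a] are the fibers of [g], one for each value. *)
  have -> : #|pblock a @: [set: 'I_n.+1]| = #|g @: [set: 'I_n.+1]|.
    have hg u : pblock a u = [set w | g w == g u].
      apply/setP => w; rewrite inE -ka eq_sym eq_pblock ?(partition_trivIset pa) //.
      by rewrite (cover_partition pa) inE.
    rewrite (eq_imset _ hg) (imset_comp (fun c => [set w | g w == c]) g).
    apply: card_in_imset => _ c' /imsetP[u _ ->] _ /setP/(_ u).
    by rewrite !inE eqxx => /esym/eqP.
  by rewrite card_join_pair // card_ord subn1.
move=> F fF; rewrite flat_le_coarser //; last by rewrite inE.
have pF : partition F [set: 'I_n.+1] by rewrite inE in fF.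
rewrite -(coarser_join_pair _ _ pF); apply: eq_forallb_in => u _.
by apply: eq_forallb_in => v _; rewrite ka.
Qed.

Theorem theorem1p2 (n k : nat) (A : {set {set {set 'I_n.+1}}}) :
  2 <= k -> 8 * k <= n.+1 ->
  A \subset flats_of_rank n k -> intersecting A ->
  #|A| <= bracket n.-1 k.-1 /\
  (#|A| = bracket n.-1 k.-1 <-> full_edge_star k A).
Proof.
move=> k2 kn sA iA.
have sF : A \subset flats n.
  by apply: subset_trans sA _; apply/subsetP => F; rewrite inE => /andP[].
have mA := intersecting_meeting sF iA.
have cN : #|'I_n.+1| = n.+1 := card_ord _.
have k0 : 0 < k by lia.
have kN : 8 * k <= #|'I_n.+1| by rewrite cN.
have eR : flats_of_rank n k = parts [set: 'I_n.+1] (#|'I_n.+1| - k).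
  by rewrite cN flats_of_rankE //; lia.
(* Both sides are [S(n, n + 1 - k)]; [n] and [k] are positive, so the predecessors do not
   truncate. *)
have -> : bracket n.-1 k.-1 = st #|'I_n.+1|.-1 (#|'I_n.+1| - k).
  by rewrite /bracket stirling2E cN; congr st; lia.
have flatR F : F \in flats_of_rank n k -> F \in flats n by rewrite inE => /andP[].
have full_card : full_edge_star k A -> #|A| = st #|'I_n.+1|.-1 (#|'I_n.+1| - k).
  case=> a aA ->; have := aA; rewrite /atoms flats_of_rankE // inE => /andP[pa /eqP ca].
  have -> : #|'I_n.+1|.-1 = #|pblock a @: [set: 'I_n.+1]| by rewrite pblock_setT // ca cN subn1.
  rewrite -card_coarser -eR; apply: eq_card => F; rewrite [LHS]inE [RHS]inE.
  by apply: andb_id2l => /flatR fF; rewrite flat_le_coarser // inE.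
rewrite eR in sA.
(* With a common edge, [A] lies in a star and equality means being all of it; otherwise the bound is
   strict, so [A] is no star. *)
have [/existsP[[x y] /andP[/= nxy /forall_inP common]]|none] :=
    boolP [exists p : 'I_n.+1 * 'I_n.+1, (p.1 != p.2) && [forall F in A, tog F p.1 p.2]].
  have AS : A \subset [set F in parts [set: 'I_n.+1] (#|'I_n.+1| - k) | tog F x y].
    by apply/subsetP => F FA; rewrite inE common // (subsetP sA).
  rewrite -(card_star _ nxy); split; first exact: subset_leq_card.
  split=> [e|/full_card ->]; last by rewrite card_star.
  have [a aA ha] : exists2 a, a \in atoms n &
      forall F, F \in flats n -> flat_le a F = tog F x y by apply: atom_of_pair => //; lia.
  exists a => //; have -> : A = [set F in parts [set: 'I_n.+1] (#|'I_n.+1| - k) | tog F x y].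
    by apply/eqP; rewrite eqEcard AS e leqnn.
  apply/setP => F; rewrite [LHS]inE [RHS]inE eR; apply: andb_id2l.
  by rewrite -eR => /flatR /ha.
have lt : #|A| < st #|'I_n.+1|.-1 (#|'I_n.+1| - k).
  apply: nonstar_bound => // x y nxy.
  move: none; rewrite negb_exists => /forallP/(_ (x, y)); rewrite nxy /=.
  by rewrite negb_forall_in => /exists_inP.
split; first exact: ltnW.
by split=> [e|/full_card //]; rewrite e ltnn in lt.
Qed.
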